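(* Let $\mathcal C\subseteq\mathbb R^d$ be nonempty, compact and convex, and let $f\colon\mathbb R^d\to\mathbb R$ be convex, continuously differentiable and $L$-smooth on $\mathcal C$ for some $L>0$. Let $\mathcal M=\operatorname{argmin}_{x\in\mathcal C}f(x)$ and $f^\star=\min_{x\in\mathcal C}f(x)$. Suppose that $\mathcal C$, together with its fixed LMO selector $S$, satisfies local dual sharpness around $\mathcal M$ with some constants $(A,q)$, where $A>0$ and $q\ge 2$. Let $(x_t)$ be the Frank--Wolfe iterates (from an arbitrary $x_0\in\mathcal C$) generated with the global short-step rule, or with exact line search. Then in both cases $$f(x_t)-f^\star=o(1/t)\qquad (t\to\infty).$$
   Context: Norms are Euclidean. Coordinates are taken on the affine hull of $\mathcal C$; equivalently, the definitions are read relative to $\operatorname{aff}(\mathcal C)$, with directions and gradients projected to its linear span. $L$-smooth on $\mathcal C$: $f(y)\le f(x)+\langle\nabla f(x),y-x\rangle+\frac L2\|y-x\|^2$ for all $x,y\in\mathcal C$. LMO selector: a fixed deterministic map $S\colon\mathbb R^d\to\mathcal C$ with $S(g)\in\operatorname{argmin}_{s\in\mathcal C}\langle g,s\rangle$ for every $g$. Frank--Wolfe: given $x_0\in\mathcal C$, for $t=0,1,2,\dots$ set $s_t=S(\nabla f(x_t))$ and $x_{t+1}=x_t+\gamma_t(s_t-x_t)$ with $\gamma_t\in[0,1]$. Write $g_t=\langle\nabla f(x_t),x_t-s_t\rangle$ and $d_t=\|x_t-s_t\|$. Global short-step rule: $\gamma_t=\min\{g_t/(Ld_t^2),1\}$ (if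 $d_t=0$, then $x_{t+1}=x_t$ for any $\gamma_t\in[0,1]$). Exact line search: $\gamma_t\in\operatorname{argmin}_{\gamma\in[0,1]}f(x_t+\gamma(s_t-x_t))$. Local dual sharpness (LDS): for nonempty $M\subseteq\mathcal C$, $A>0$ and real $q\ge2$, $\mathcal C$ together with the selector $S$ satisfies local dual sharpness around $M$ with constants $(A,q)$ if there is $\rho>0$ such that for every $x\in\mathcal C$ with $\operatorname{dist}(x,M)<\rho$ and every $g\in\mathbb R^d$, $$A\|g\|\,\|x-S(g)\|^q\le\langle g,x-S(g)\rangle .$$ *)

(* Defs.v *)
From mathcomp Require Import all_boot all_order all_algebra.
From mathcomp Require Import all_classical all_reals all_analysis.
Set Implicit Arguments.
Unset Strict Implicit.
Unset Printing Implicit Defensive.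
Import Order.TTheory GRing.Theory Num.Theory.
Import numFieldNormedType.Exports.
Local Open Scope classical_set_scope.
Local Open Scope ring_scope.

Section euclidean.
Context {R : realType} {d : nat}.
Implicit Types (u v x y : 'rV[R]_d) (A V : set 'rV[R]_d).

Definition dot u v : R := \sum_(i < d) u 0 i * v 0 i.

(* The library norm `|u| on row vectors is the sup norm; it induces the same
   topology, but the norms used here are Euclidean. *)
Definition enorm u : R := Num.sqrt (dot u u).

Definition edist_set x A : R := inf [set enorm (x - y) | y in A].

Definition lin_span A : set 'rV[R]_d :=
  [set v | exists n (c : 'I_n -> R) (w : 'I_n -> 'rV[R]_d),
     (forall i, A (w i)) /\ v = \sum_(i < n) c i *: w i].

(* The linear span (direction space) of the affine hull of A. *)
Definition dir_space A : set 'rV[R]_d :=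
  lin_span [set z | exists x y, [/\ A x, A y & z = y - x]].

(* For a linear subspace V there is exactly one such p, so the default value 0
   is never taken. *)
Definition orth_proj V v : 'rV[R]_d :=
  xget 0 [set p | V p /\ forall w, V w -> dot (v - p) w = 0].

End euclidean.

Definition argmin {R : realType} {T : Type} (D : set T) (h : T -> R) : set T :=
  [set x | D x /\ forall y, D y -> h x <= h y].

Section objective.
Context {R : realType} {d : nat}.
Implicit Types (C : set 'rV[R]_d) (f : 'rV[R]_d -> R).

Definition grad f (x : 'rV[R]_d) : 'rV[R]_d :=
  \row_(i < d) 'D_(delta_mx 0 i) f x.

Definition continuously_differentiable f : Prop :=
  (forall x, differentiable f x) /\ continuous (grad f).

(* The gradient of f relative to aff(C). It has the same inner product with
   every y - x, for x and y in C, as the ambient gradient. *)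
Definition rel_grad C f (x : 'rV[R]_d) : 'rV[R]_d :=
  orth_proj (dir_space C) (grad f x).

Definition smooth_on C f (L : R) : Prop :=
  forall x y, C x -> C y ->
    f y <= f x + dot (rel_grad C f x) (y - x) + L / 2 * enorm (y - x) ^+ 2.

End objective.

Section frank_wolfe.
Context {R : realType} {d : nat}.
Variables (C : set 'rV[R]_d) (S : 'rV[R]_d -> 'rV[R]_d).

(* Read relative to aff(C), the directions g range over dir_space C, and the
   values of S outside dir_space C are irrelevant. With g ranging over the
   whole ambient space, local dual sharpness would be violated by any nonzero
   normal of aff(C) as soon as C is not full-dimensional and has at least two
   points. *)
Definition lmo_selector : Prop :=
  forall g, dir_space C g -> argmin C (dot g) (S g).

Definition local_dual_sharpness (M : set 'rV[R]_d) (A q : R) : Prop :=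
  exists rho : R, 0 < rho /\
    forall x g, C x -> edist_set x M < rho -> dir_space C g ->
      A * enorm g * (enorm (x - S g) `^ q) <= dot g (x - S g).

Variable f : 'rV[R]_d -> R.

Definition fw_vertex (x : 'rV[R]_d) : 'rV[R]_d := S (rel_grad C f x).

Definition fw_gap (x : 'rV[R]_d) : R :=
  dot (rel_grad C f x) (x - fw_vertex x).

Definition fw_dist (x : 'rV[R]_d) : R := enorm (x - fw_vertex x).

Definition frank_wolfe (x : nat -> 'rV[R]_d) (gamma : nat -> R) : Prop :=
  C (x 0%N) /\
  forall t, [/\ 0 <= gamma t, gamma t <= 1 &
    x t.+1 = x t + gamma t *: (fw_vertex (x t) - x t)].

Definition short_step (L : R) (x : nat -> 'rV[R]_d) (gamma : nat -> R) : Prop :=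
  forall t, fw_dist (x t) != 0 ->
    gamma t = Num.min (fw_gap (x t) / (L * fw_dist (x t) ^+ 2)) 1.

Definition exact_line_search (x : nat -> 'rV[R]_d) (gamma : nat -> R) : Prop :=
  forall t, argmin [set a : R | 0 <= a <= 1]
    (fun a => f (x t + a *: (fw_vertex (x t) - x t))) (gamma t).

End frank_wolfe.

(* Main.v *)
(** Write [h] for the primal gap, [g] for the Frank-Wolfe gap, [d] for the
distance from the iterate to its vertex, [G] for the relative gradient and
[delta] for the distance from the iterate to the minimizers.  By convexity,
[h <= g] and [h <= |G| delta]; by compactness, [delta] tends to 0 with [h].

Smoothness makes both step rules decrease [h] by at least the minimum of
[g^2 / (2 L d^2)] and [g / 2].  Hence a bound [g >= K h d] yields a recursion
[h' <= h - k h^2] with [k] of order [K^2], so that [h] is at most about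
[1 / (k t)].  Boundedness of [C] gives the bound for one [K], whence [h -> 0].

Sharpness then gives it eventually for every [K], which is the [o(1/t)] rate:
if [g < K h d], then [h <= g] forces [d > 1/K], and sharpness yields
[A |G| K^(-q) <= g < K h d <= K diam(C) |G| delta], which is impossible for
small [delta].  The factor [|G|] cancels, so that gradients vanishing at the
minimizers do no harm. *)

Require Import Defs.
From mathcomp Require Import all_boot all_order all_algebra.
From mathcomp Require Import all_classical all_reals all_analysis.
From mathcomp Require Import ring lra.
Import Order.TTheory GRing.Theory Num.Theory.
Import numFieldNormedType.Exports.
Local Open Scope classical_set_scope.
Local Open Scope ring_scope.

(** * Euclidean geometry and orthogonal projection *)

Section euclidean.
Set Implicit Arguments.
Unset Strict Implicit.
Context {R : realType} {d : nat}.
Implicit Types (u v w x y : 'rV[R]_d) (V C : set 'rV[R]_d).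

Lemma dotE u v : dot u v = (u *m v^T) 0 0.
Proof. by rewrite mxE; apply: eq_bigr => i _; rewrite mxE. Qed.

Lemma dotC u v : dot u v = dot v u.
Proof. by apply: eq_bigr => i _; rewrite mulrC. Qed.

Lemma dotDl u v w : dot (u + v) w = dot u w + dot v w.
Proof. by rewrite !dotE mulmxDl mxE. Qed.

Lemma dotZl (a : R) u v : dot (a *: u) v = a * dot u v.
Proof. by rewrite !dotE -scalemxAl mxE. Qed.

Lemma dotNl u v : dot (- u) v = - dot u v.
Proof. by rewrite -scaleN1r dotZl mulN1r. Qed.

Lemma dotBl u v w : dot (u - v) w = dot u w - dot v w.
Proof. by rewrite dotDl dotNl. Qed.

Lemma dotZr (a : R) u v : dot u (a *: v) = a * dot u v.
Proof. by rewrite dotC dotZl dotC. Qed.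

Lemma dotBr u v w : dot w (u - v) = dot w u - dot w v.
Proof. by rewrite !(dotC w) dotBl. Qed.

Lemma dot_ge0 u : 0 <= dot u u.
Proof. by apply: sumr_ge0 => i _; rewrite -expr2 sqr_ge0. Qed.

Lemma dot_eq0 u : dot u u = 0 -> u = 0.
Proof.
move=> /eqP; rewrite psumr_eq0 => [/allP u0|i _]; last by rewrite -expr2 sqr_ge0.
apply/rowP => i; rewrite mxE; apply/eqP; rewrite -sqrf_eq0 expr2.
exact: (implyP (u0 i (mem_index_enum _))).
Qed.

Lemma enorm_ge0 u : 0 <= enorm u.
Proof. exact: sqrtr_ge0. Qed.

Lemma sqr_enorm u : enorm u ^+ 2 = dot u u.
Proof. by rewrite sqr_sqrtr// dot_ge0. Qed.

Lemma enorm_eq0 u : enorm u = 0 -> u = 0.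
Proof. by move=> u0; apply: dot_eq0; rewrite -sqr_enorm u0 expr0n. Qed.

Lemma enormN u : enorm (- u) = enorm u.
Proof. by rewrite /enorm dotNl dotC dotNl opprK. Qed.

Lemma cauchy_schwarz u v : dot u v <= enorm u * enorm v.
Proof.
have [->|v0] := eqVneq v 0.
  have d0 w : dot w 0 = 0 by rewrite -(scale0r w) dotZr mul0r.
  by rewrite /enorm !d0 sqrtr0 mulr0.
have ev0 : 0 < enorm v.
  by rewrite lt_neqAle enorm_ge0 andbT eq_sym; apply: contra_neq v0 => /enorm_eq0.
(* This squared norm expands to [|v|^2 * (|u|^2 |v|^2 - (dot u v)^2)]. *)
have := dot_ge0 (enorm v ^+ 2 *: u - dot u v *: v).
rewrite !(dotBl, dotBr, dotZl, dotZr) (dotC v u) -!sqr_enorm.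
set a := enorm u; set b := enorm v in ev0 *; set c := dot u v => H.
have {}H : 0 <= b ^+ 2 * ((a * b) ^+ 2 - c ^+ 2).
  by apply: le_trans H _; rewrite le_eqVlt; apply/orP; left; apply/eqP; ring.
move: H; rewrite pmulr_rge0 ?exprn_gt0// subr_ge0 => cab.
rewrite (le_trans (ler_norm c))// -(ler_pXn2r (n := 2))//.
- by rewrite real_normK ?num_real.
- by rewrite nnegrE mulr_ge0 ?enorm_ge0.
Qed.

Lemma enorm_continuous : continuous (@enorm R d).
Proof.
move=> u; apply: (@continuous_comp _ _ _ (fun v => dot v v) Num.sqrt).
  apply: continuous_big => [|i _ v]; first exact: add_continuous.
  by apply: continuousM; exact: (@coord_continuous _ 1 d 0 i v).
exact: sqrt_continuous.
Qed.

Definition subspace_set V :=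
  forall (a : R) u v, V u -> V v -> V (a *: u + v).

Lemma subspace_set_lin_span (E : set 'rV[R]_d) : subspace_set (lin_span E).
Proof.
move=> a _ _ [m [c [w [Ew ->]]]] [n [c' [w' [Ew' ->]]]].
exists (m + n)%N.
exists (fun i => match fintype.split i with inl j => a * c j | inr k => c' k end).
exists (fun i => match fintype.split i with inl j => w j | inr k => w' k end); split.
  by move=> i; case: splitP.
rewrite big_split_ord/= scaler_sumr; congr (_ + _); apply: eq_bigr => i _.
  by rewrite -/(unsplit (inl i)) unsplitK scalerA.
by rewrite -/(unsplit (inr i)) unsplitK.
Qed.

Lemma dir_space0 C : dir_space C 0.
Proof.
exists 0%N, (fun=> 0), (fun=> 0); split; first by case.
by rewrite big_ord0.
Qed.

Lemma dir_spaceB C x y : C x -> C y -> dir_space C (y - x).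
Proof.
move=> Cx Cy; exists 1%N, (fun=> 1), (fun=> y - x).
by split; [move=> _; exists x, y | rewrite big_ord1 scale1r].
Qed.

Definition orthonormal_rows k (W : 'M[R]_(k, d)) := W *m W^T = 1%:M.

Lemma orthonormal_rows_leq k (W : 'M[R]_(k, d)) : orthonormal_rows W -> (k <= d)%N.
Proof.
move=> WW; have := mxrankM_maxl W W^T.
by rewrite WW mxrank1 => /leq_trans; apply; exact: rank_leq_col.
Qed.

(* Without a projection onto V, every orthonormal family in V could be extended
   (by normalizing the part of some w in V orthogonal to it), beyond size d. *)
Lemma orth_proj_exists V v : V 0 -> subspace_set V ->
  exists p, V p /\ forall w, V w -> dot (v - p) w = 0.
Proof.
move=> V0 VS; apply: contrapT => noproj.
have VZ a u : V u -> V (a *: u) by move=> Vu; rewrite -[_ *: _]addr0; exact: VS.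
have VD u w : V u -> V w -> V (u + w).
  by move=> Vu Vw; rewrite -[u]scale1r; exact: VS.
suff fam k : exists W : 'M[R]_(k, d),
    orthonormal_rows W /\ forall c : 'rV[R]_k, V (c *m W).
  by have [W [/orthonormal_rows_leq]] := fam d.+1; rewrite ltnn.
elim: k => [|k [W [WW VW]]].
  exists 0; split; first by rewrite /orthonormal_rows; apply/matrixP; case.
  by move=> c; rewrite mulmx0.
have [w [Vw wv]] : exists w, V w /\ dot (v - v *m W^T *m W) w != 0.
  apply: contrapT => no; apply: noproj; exists (v *m W^T *m W).
  split=> // w Vw; apply/eqP; apply: contrapT => wv.
  by apply: no; exists w; split=> //; apply/negP.
pose u := w - w *m W^T *m W.
have uW : u *m W^T = 0 by rewrite mulmxBl -(mulmxA _ W) WW mulmx1 subrr.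
have Vu : V u by rewrite /u -mulNmx; apply: VD.
(* If [u] vanished, [w] would lie in the row space of [W], to which [v - v *m W^T *m W] is
   orthogonal, against [wv]. *)
have u0 : dot u u != 0.
  apply: contra_neq wv => /dot_eq0/eqP; rewrite subr_eq0 => /eqP ->.
  by rewrite dotE trmx_mul mulmxA mulmxBl -(mulmxA _ W) WW mulmx1 subrr mul0mx mxE.
have eu0 : enorm u != 0.
  by apply: contra_neq u0 => /enorm_eq0 ->; rewrite dotE mul0mx mxE.
pose e := (enorm u)^-1 *: u.
have eW : e *m W^T = 0 by rewrite -scalemxAl uW scaler0.
have We : W *m e^T = 0 by rewrite -[W]trmxK -trmx_mul eW trmx0.
have ee : e *m e^T = 1%:M.
  apply/matrixP => i j; rewrite !ord1 -dotE dotZl dotZr -sqr_enorm mxE eqxx.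
  by rewrite mulrA -invfM -expr2 mulVf// expf_neq0.
rewrite -addn1; exists (col_mx W e); split.
  by rewrite /orthonormal_rows tr_col_mx mul_col_row WW We eW ee -scalar_mx_block.
move=> c; rewrite -(hsubmxK c) mul_row_col; apply: VD => //.
have -> : rsubmx c *m e = (rsubmx c 0 0 / enorm u) *: u.
  by rewrite [X in X *m _]mx11_scalar mul_scalar_mx scalerA.
exact: VZ.
Qed.

(** Rules out the default value of [xget]. The second part lets the relative gradient replace the
    ambient one along directions of [C]. *)
Lemma orth_proj_dir_space C v : dir_space C (orth_proj (dir_space C) v) /\
  forall w, dir_space C w -> dot (orth_proj (dir_space C) v) w = dot v w.
Proof.
have [p Pp] := orth_proj_exists v (dir_space0 C)
  (@subspace_set_lin_span _).
have [Vp vp] := xgetI (0 : 'rV[R]_d) (Pp : [set p | dir_space C p /\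
  forall w, dir_space C w -> dot (v - p) w = 0] p).
split=> // w /vp /eqP; rewrite dotBl subr_eq0 => /eqP.
by move=> ->.
Qed.

End euclidean.

(** * First-order inequality for convex functions *)

Section objective.
Set Implicit Arguments.
Unset Strict Implicit.
Context {R : realType} {d : nat}.
Implicit Types (u v w x y : 'rV[R]_d) (C M : set 'rV[R]_d) (f : 'rV[R]_d -> R).

Lemma derive_dot_grad f x v : differentiable f x -> 'D_v f x = dot (grad f x) v.
Proof.
move=> df; rewrite deriveE// [in LHS](row_sum_delta v) linear_sum.
apply: eq_bigr => i _; rewrite linearZ/= mxE -deriveE//.
by rewrite mulrC.
Qed.

Lemma segmentE x y (a : R) : x + a *: (y - x) = a *: y + (1 - a) *: x.
Proof. by rewrite scalerBl scale1r scalerBr addrCA addrA. Qed.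

Lemma convex_setP C x y (a : R) : convex_set C -> C x -> C y ->
  0 <= a -> a <= 1 -> C (x + a *: (y - x)).
Proof.
move=> cC Cx Cy a0 a1.
rewrite segmentE.
exact/set_mem/(cC y x (Itv01 a0 a1) (mem_set Cy) (mem_set Cx)).
Qed.

Lemma convex_functionP f x y (a : R) : convex_function setT f ->
  0 <= a -> a <= 1 -> f (x + a *: (y - x)) <= f x + a * (f y - f x).
Proof.
move=> cf a0 a1.
have -> : f x + a * (f y - f x) = a * f y + (1 - a) * f x by ring.
rewrite segmentE.
exact: (cf (Itv01 a0 a1) y x (mem_set I) (mem_set I)).
Qed.

(** By convexity, every difference quotient along [y - x] with step in [(0, 1]] is at most
    [f y - f x]; the derivative is the limit of these quotients. *)
Lemma convex_function_grad f x y : convex_function setT f ->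
  differentiable f x -> dot (grad f x) (y - x) <= f y - f x.
Proof.
move=> cf df; rewrite -derive_dot_grad//; apply/ler_addgt0Pr => e e0.
have := @diff_derivable _ _ _ f x (y - x) df => /cvgr_dist_lt/(_ _ e0).
move=> [r /= r0 H].
(* Below [r], so that the quotient is [e]-close to the derivative, and at most 1, so that convexity
   applies. *)
pose h : R := Num.min (r / 2) 1.
have h0 : 0 < h by rewrite lt_min ltr01 divr_gt0.
have h1 : h <= 1 by rewrite ge_min lexx orbT.
have hr : ball_ Num.norm 0 r h.
  rewrite /ball_/= sub0r normrN gtr0_norm//.
  by rewrite (@le_lt_trans _ _ (r / 2))// ?ge_min ?lexx// ltr_pdivrMr// ltr_pMr// ltr1n.
have /(le_lt_trans (ler_norm _)) := H _ hr (lt0r_neq0 h0).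
set q := _^-1 *: _ => Dq; have {Dq} : 'D_(y - x) f x <= e + q.
  by rewrite -lerBlDr ltW.
move=> /le_trans; apply; rewrite [leRHS]addrC lerD2l.
rewrite /q [_ *: _]mulrC ler_pdivrMr// lerBlDl mulrC addrC.
by apply: convex_functionP => //; exact: ltW.
Qed.

End objective.

(** * Minimizers on a compact set *)

Section minimizers.
Set Implicit Arguments.
Unset Strict Implicit.
Context {R : realType} {d : nat}.
Implicit Types (u v w x y m : 'rV[R]_d) (C M : set 'rV[R]_d).
Implicit Types (f : 'rV[R]_d -> R).

Lemma edist_set_le M x m : M m -> edist_set x M <= enorm (x - m).
Proof.
move=> Mm; apply: ge_inf; last by exists m.
by exists 0 => _ [y _ <-]; exact: enorm_ge0.
Qed.

Lemma inf_argmin C f m : argmin C f m -> inf [set f y | y in C] = f m.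
Proof.
move=> [Cm minm]; apply/eqP; rewrite eq_le; apply/andP; split.
  by apply: ge_inf; [exists (f m) => _ [y Cy <-]; exact: minm | exists m].
by apply: lb_le_inf; [exists (f m), m | move=> _ [y Cy <-]; exact: minm].
Qed.

Lemma argmin_nonempty C f : C !=set0 -> compact C -> continuous f ->
  argmin C f !=set0.
Proof.
move=> C0 cC cf.
have [m /set_mem Cm minm] := EVT_min_rV C0 cC (continuous_subspaceT cf).
by exists m; split=> // y /mem_set; exact: minm.
Qed.

(** Removing from [C] the open [e]-neighbourhood [U] of the minimizers leaves a compact set. If it
    is nonempty, [f] attains its minimum there, strictly above the global one, and [r] is the
    difference of the two. *)
Lemma near_argmin C f (e : R) : C !=set0 -> compact C -> continuous f ->
  0 < e -> exists2 r : R, 0 < r & forall x, C x ->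
    f x - inf [set f y | y in C] < r ->
    exists2 m, argmin C f m & enorm (x - m) < e.
Proof.
move=> C0 cC cf e0.
have [m Mm] := argmin_nonempty C0 cC cf.
pose U := \bigcup_(m in argmin C f) [set x | enorm (x - m) < e].
have oU : open U.
  apply: bigcup_open => y _.
  have cy : continuous (fun x => enorm (x - y)).
    move=> x; apply: (@continuous_comp _ _ _ (fun x => x - y)).
      by apply: continuousB => //; exact: cst_continuous.
    exact: enorm_continuous.
  rewrite (_ : mkset _ = (fun x => enorm (x - y)) @^-1` [set r | r < e])//.
  by apply: open_comp => [x _|]; [exact: cy|exact: open_lt].
have [K0|K0] := eqVneq (C `&` ~` U) set0.
  exists 1 => // x Cx _.
  have [m' Mm' xm'] : U x.
    by apply: contrapT => Ux; suff : set0 x by []; rewrite -K0.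
  by exists m'.
have [z /set_mem[Cz Uz] minz] := EVT_min_rV ((set0P _).1 K0)
  (compact_closedI cC (open_closedC oU)) (continuous_subspaceT cf).
rewrite (inf_argmin Mm); exists (f z - f m) => [|x Cx].
  rewrite subr_gt0 ltNge; apply/negP => zm; apply: Uz; exists z => /=.
    by split=> // y /(proj2 Mm); exact: le_trans.
  by rewrite subrr /enorm dotE mul0mx mxE sqrtr0.
rewrite ltrD2r => xz.
have [m' Mm' xm'] : U x.
  apply: contrapT => Ux; move: xz; rewrite ltNge minz//.
  exact/mem_set.
by exists m'.
Qed.

Lemma compact_enorm_bounded C : C !=set0 -> compact C ->
  exists2 D : R, 0 < D & forall x y, C x -> C y -> enorm (x - y) <= D.
Proof.
move=> C0 cC.
have [m _ maxm] := EVT_max_rV C0 cC (continuous_subspaceT (@enorm_continuous R d)).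
(* The added 1 keeps the bound positive even when [C] is the origin alone. *)
exists (2 * (enorm m + 1)).
  by rewrite mulr_gt0// ltr_wpDl ?enorm_ge0.
move=> x y /mem_set/maxm xm /mem_set/maxm ym.
rewrite -(ler_pXn2r (n := 2))// ?nnegrE ?enorm_ge0//; last first.
  by rewrite mulr_ge0// addr_ge0 ?enorm_ge0.
rewrite sqr_enorm dotBl !dotBr (dotC y x) -!sqr_enorm.
have := cauchy_schwarz (- x) y; rewrite dotNl enormN.
have := enorm_ge0 x; have := enorm_ge0 y; have := enorm_ge0 m.
by nra.
Qed.

End minimizers.

(** * Rates from a quadratic decrease recursion *)

Section recursion.
Set Implicit Arguments.
Unset Strict Implicit.
Context {R : realType}.
Implicit Types (a : nat -> R) (k : R).

Lemma quadratic_decrease_rate a k N : 0 < k -> (forall t, 0 <= a t) ->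
  (forall t, (N <= t)%N -> a t.+1 <= a t - k * a t ^+ 2) ->
  forall n, k * n%:R * a (N + n)%N <= 1.
Proof.
move=> k0 a0 dec; elim=> [|n IHn]; first by rewrite mulr0 mul0r.
have := dec (N + n)%N (leq_addr _ _); rewrite addnS.
have := a0 (N + n)%N; have := a0 (N + n).+1.
move: IHn; rewrite -natr1; set u := a (N + n)%N; set u' := a (N + n).+1.
have := ler0n R n; move: (n%:R : R) => r r0 IH u'0 u0 le.
have {}le : k * u' <= k * u - (k * u) ^+ 2 by nra.
have {}IH : r * (k * u) <= 1 by nra.
have ku0 : 0 <= k * u by rewrite mulr_ge0 ?(ltW k0).
(* The induction hypothesis does not give this at [n = 0]; nonnegativity of the next term does. *)
have ku1 : k * u <= 1 by have : 0 <= k * u' by [rewrite mulr_ge0 ?(ltW k0)]; nra.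
have -> : k * (r + 1) * u' = (r + 1) * (k * u') by ring.
apply: (@le_trans _ _ ((r + 1) * (k * u - (k * u) ^+ 2))).
  by rewrite ler_pM2l//; lra.
(* With [z = k * u], [1 - (r + 1) (z - z^2) = (1 - r z) (1 - z) + z^2], a sum of nonnegative
   terms. *)
by nra.
Qed.

Lemma quadratic_decrease_lt a k N (e : R) : 0 < k -> (forall t, 0 <= a t) ->
  (forall t, (N <= t)%N -> a t.+1 <= a t - k * a t ^+ 2) ->
  0 < e -> \forall t \near \oo, a t < e.
Proof.
move=> k0 a0 dec e0.
have rate := quadratic_decrease_rate k0 a0 dec.
near=> t.
have Nt : (N <= t)%N by near: t; exact: nbhs_infty_ge.
have := rate (t - N)%N; rewrite subnKC// => rt.
have nt : (k * e)^-1 < (t - N)%:R.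
  rewrite natrB// ltrBrDr; near: t; exact: nbhs_infty_gtr.
rewrite -(ltr_pM2l (x := k * (t - N)%:R)) ?mulr_gt0//.
  apply: le_lt_trans rt _; rewrite mulrAC.
  by rewrite mulrC -ltr_pdivrMr ?mulr_gt0// div1r.
by rewrite (lt_trans _ nt)// invr_gt0 mulr_gt0.
Unshelve. all: by end_near. Qed.

Lemma quadratic_decrease_littleo a : (forall t, 0 <= a t) ->
  (forall k, 0 < k ->
    \forall t \near \oo, a t.+1 <= a t - k * a t ^+ 2) ->
  (a : nat -> R^o) =o_\oo (fun t : nat => t%:R^-1 : R^o).
Proof.
move=> a0 dec; apply/eqoP => e e0.
(* The rate gives [a t <= e / (2 (t - N))]; the factor 2 absorbs the shift, since [t <= 2 (t - N)]
   once [t >= 2 N]. *)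
have k0 : 0 < 2 / e by rewrite divr_gt0.
have [N _ HN] := dec _ k0.
have rate := quadratic_decrease_rate k0 a0 HN.
near=> t; rewrite ger0_norm// ger0_norm ?invr_ge0//.
have Nt : (N * 2 <= t)%N by near: t; exact: nbhs_infty_ge.
have t0 : (0 < t)%N by near: t; exact: nbhs_infty_gt.
have Nt' : (N <= t)%N by rewrite (leq_trans _ Nt)// leq_pmulr.
have := rate (t - N)%N; rewrite subnKC// natrB// => rt.
rewrite ler_pdivlMr ?ltr0n//.
have : (N%:R * 2 <= t%:R :> R) by rewrite -natrM ler_nat.
have tR : 0 < t%:R :> R by rewrite ltr0n.
have ut := a0 t; set u := a t in ut rt *; set T : R := t%:R in rt *.
move: (N%:R : R) rt => n rt nT.
apply: (@le_trans _ _ (e * (2 / e * (T - n) * u))); last first.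
  by apply: ler_piMr => //; exact: ltW.
have -> : e * (2 / e * (T - n) * u) = u * (2 * (T - n)) by field; exact: lt0r_neq0.
by apply: ler_wpM2l => //; lra.
Unshelve. all: by end_near. Qed.

End recursion.

(** * Decrease of the objective in one Frank-Wolfe step *)

Section frank_wolfe.
Set Implicit Arguments.
Unset Strict Implicit.
Context {R : realType} {d : nat}.
Context (C : set 'rV[R]_d) (f : 'rV[R]_d -> R) (S : 'rV[R]_d -> 'rV[R]_d).
Context (L : R).
Implicit Types (x y : 'rV[R]_d).
Hypotheses (C_convex : convex_set C) (f_convex : convex_function setT f).
Hypotheses (f_diff : forall x, differentiable f x) (L_gt0 : 0 < L).
Hypotheses (f_smooth : smooth_on C f L) (S_lmo : lmo_selector C S).

Lemma dir_space_rel_grad x : dir_space C (rel_grad C f x).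
Proof. exact: (orth_proj_dir_space C (grad f x)).1. Qed.

Lemma fw_vertex_mem x : C (fw_vertex C S f x).
Proof. exact: (S_lmo (dir_space_rel_grad x)).1. Qed.

Lemma rel_grad_convex x y : C x -> C y -> f x - f y <= dot (rel_grad C f x) (x - y).
Proof.
move=> Cx Cy.
rewrite (orth_proj_dir_space C _).2; last exact: dir_spaceB.
have := convex_function_grad y f_convex (f_diff x).
by rewrite !dotBr; lra.
Qed.

Lemma fw_gap_ge x y : C x -> C y -> f x - f y <= fw_gap C S f x.
Proof.
move=> Cx Cy; apply: le_trans (rel_grad_convex Cx Cy) _.
have := (S_lmo (dir_space_rel_grad x)).2 y Cy.
by rewrite /fw_gap /fw_vertex !dotBr; lra.
Qed.

(** Over [[0, 1]], this minimizes the quadratic upper bound given by smoothness, and serves as the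
    benchmark for both step rules. At zero distance, division by zero makes it 0. *)
Definition short_step_size x : R :=
  Num.min (fw_gap C S f x / (L * fw_dist C S f x ^+ 2)) 1.

Lemma short_step_size_itv x : C x -> 0 <= short_step_size x <= 1.
Proof.
move=> Cx; rewrite /short_step_size ge_min lexx orbT andbT le_min ler01 andbT.
have := fw_gap_ge Cx Cx; rewrite subrr => g0.
by rewrite divr_ge0// mulr_ge0 ?sqr_ge0// ltW.
Qed.

(** Write [g] for the gap and [D] for the distance. If [0 < D] and [g <= L D^2], the decrease is at
    least [g^2 / (2 L D^2) >= K^2 h^2 / (2 L) >= k h^2]. A full step, with [g > L D^2], gains at
    least [g / 2 >= h / 2 >= k h^2]. *)
Lemma short_step_decrease x (h K k : R) : C x -> 0 <= h -> h <= fw_gap C S f x ->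
  0 <= K -> K * h * fw_dist C S f x <= fw_gap C S f x ->
  2 * L * k <= K ^+ 2 -> 2 * k * h <= 1 ->
  f (x + short_step_size x *: (fw_vertex C S f x - x)) <= f x - k * h ^+ 2.
Proof.
move=> Cx h0 hg K0 Khd LkK kh.
have /andP[c0 c1] := short_step_size_itv Cx.
set s := fw_vertex C S f x; set c := short_step_size x in c0 c1 *.
have Cy := convex_setP C_convex Cx (fw_vertex_mem x) c0 c1.
apply: (le_trans (f_smooth Cx Cy)).
rewrite (addrC x (_ *: _)) addrK -/s dotZr sqr_enorm dotZl dotZr -sqr_enorm.
have -> : dot (rel_grad C f x) (s - x) = - fw_gap C S f x.
  by rewrite /fw_gap -/s !dotBr; ring.
have -> : enorm (s - x) = fw_dist C S f x by rewrite -enormN opprB.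
move: c0 c1 Khd hg; rewrite /c /short_step_size.
have := cauchy_schwarz (rel_grad C f x) (x - s).
have := enorm_ge0 (x - s).
rewrite -/(fw_gap C S f x) -/(fw_dist C S f x).
move: (fw_dist C S f x) (fw_gap C S f x) => D g D0 gD c0 c1 Khd hg.
(* At zero distance, Cauchy-Schwarz forces the gap, hence [h], to vanish. *)
have [D_eq0|Dn0] := eqVneq D 0.
  move: gD; rewrite D_eq0 mulr0 => g0.
  have -> : h = 0 by lra.
  have -> : g = 0 by lra.
  by rewrite mul0r min_l// ?ler01//; lra.
have LD0 : 0 < L * D ^+ 2 by rewrite mulr_gt0// exprn_gt0// lt_neqAle eq_sym Dn0.
have [gLD|gLD] := leP (g / (L * D ^+ 2)) 1; last first.
  move: gLD; rewrite ltr_pdivlMr// mul1r => gLD.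
  have : 2 * (k * h ^+ 2) <= h by rewrite mulrA expr2 mulrA ler_piMl.
  by lra.
set c' := g / _.
have cLD : c' * (L * D ^+ 2) = g by rewrite divfK// gt_eqF.
suff : 2 * (k * h ^+ 2) <= c' * g by nra.
rewrite mulrAC ler_pdivlMr// -expr2.
have h2 : 0 <= (h * D) ^+ 2 by rewrite sqr_ge0.
have : (2 * L * k) * (h * D) ^+ 2 <= K ^+ 2 * (h * D) ^+ 2 by rewrite ler_wpM2r.
have : (K * h * D) ^+ 2 <= g ^+ 2.
  by rewrite lerXn2r ?nnegrE ?mulr_ge0// (le_trans h0).
by nra.
Qed.

(** Exact line search does at least as well as any competitor in [[0, 1]]. The short-step rule gives
    equality; at zero distance it leaves [gamma t] free, but then the iterate does not move. *)
Lemma fw_step_decrease (x : nat -> 'rV[R]_d) gamma t : frank_wolfe C S f x gamma ->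
  short_step C S f L x gamma \/ exact_line_search C S f x gamma ->
  C (x t) ->
  f (x t.+1) <=
    f (x t + short_step_size (x t) *: (fw_vertex C S f (x t) - x t)).
Proof.
move=> [_ /(_ t)[_ _ ->]] rule Cx.
case: rule => [/(_ t) ss|/(_ t)[_]].
  have [d0|/ss ->//] := eqVneq (fw_dist C S f (x t)) 0.
  have /eqP := enorm_eq0 d0; rewrite subr_eq0 => /eqP <-.
  by rewrite subrr !scaler0.
exact: (fun H => H _ (short_step_size_itv Cx)).
Qed.

Lemma fw_mem (x : nat -> 'rV[R]_d) gamma t : frank_wolfe C S f x gamma -> C (x t).
Proof.
move=> [C0 step]; elim: t => // t Cx; have [g0 g1 ->] := step t.
exact: convex_setP (fw_vertex_mem _) g0 g1.
Qed.

End frank_wolfe.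

(** * Convergence to zero, then the sharpened rate *)

Theorem corollary3p8 (R : realType) (d : nat)
    (C : set 'rV[R]_d) (f : 'rV[R]_d -> R) (L : R)
    (S : 'rV[R]_d -> 'rV[R]_d) (A q : R)
    (x : nat -> 'rV[R]_d) (gamma : nat -> R) :
  C !=set0 -> compact C -> convex_set C ->
  convex_function setT f -> continuously_differentiable f ->
  0 < L -> smooth_on C f L ->
  lmo_selector C S ->
  0 < A -> 2 <= q -> local_dual_sharpness C S (argmin C f) A q ->
  frank_wolfe C S f x gamma ->
  short_step C S f L x gamma \/ exact_line_search C S f x gamma ->
  (fun t : nat => f (x t) - inf [set f y | y in C] : R^o) =o_\oo
    (fun t : nat => t%:R^-1 : R^o).
Proof.
move=> C0 cC convC convf [df _] L0 smf lmo A0 q2 [rho [rho0 lds]] fw rule.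
have cf : continuous f by move=> y; exact/differentiable_continuous/df.
have [m0 Mm0] := argmin_nonempty C0 cC cf.
have fstar := inf_argmin Mm0.
set a : nat -> R := fun t => f (x t) - inf [set f y | y in C].
have Cx t : C (x t) := fw_mem convC lmo t fw.
have a0 t : 0 <= a t by rewrite /a fstar subr_ge0; exact: Mm0.2.
have a_gap t : a t <= fw_gap C S f (x t).
  by rewrite /a fstar; apply: fw_gap_ge => //; exact: Mm0.1.
have step t K k : 0 <= K -> K * a t * fw_dist C S f (x t) <= fw_gap C S f (x t) ->
    2 * L * k <= K ^+ 2 -> 2 * k * a t <= 1 -> a t.+1 <= a t - k * a t ^+ 2.
  move=> K0 KaD LkK ka.
  have le1 := fw_step_decrease convf df L0 lmo fw rule (Cx t).
  have le2 := short_step_decrease convC convf df L0 smf lmo (Cx t) (a0 t)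
    (a_gap t) K0 KaD LkK ka.
  by have := le_trans le1 le2; rewrite /a; lra.
have [D D0 diam] := compact_enorm_bounded C0 cC.
have dist_le t : fw_dist C S f (x t) <= D.
  by apply: diam => //; exact: fw_vertex_mem.
have a_le t : a t <= a 0%N.
  elim: t => // t; apply: le_trans.
  (* Taking [K = k = 0] gives monotonicity, which bounds [a t] uniformly for the choice of [k]
     below. *)
  have := step t 0 0; rewrite !mul0r subr0; apply => //.
  - exact: le_trans (a_gap t).
  - by rewrite mulr0 expr0n.
  - by rewrite mulr0 mul0r.
have a_small (e : R) : 0 < e -> \forall t \near \oo, a t < e.
  (* The two entries secure [2 L k <= K^2] for [K = 1/D], and [2 k a t <= 1]. This [K] is admissible
     because distances are at most [D] and [a t] is at most the gap. *)
  pose k := Num.min ((D^-1) ^+ 2 / (2 * L)) ((2 * (a 0%N + 1))^-1).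
  have k0 : 0 < k.
    rewrite lt_min divr_gt0 ?mulr_gt0 ?exprn_gt0 ?invr_gt0//.
    by rewrite mulr_gt0// ltr_wpDl.
  apply: (quadratic_decrease_lt (N := 0%N) k0) => // t _.
  apply: (step t D^-1) => //.
  - by rewrite invr_ge0 ltW.
  - apply: le_trans (a_gap t); rewrite mulrAC mulrC ler_piMr//.
    by rewrite mulrC ler_pdivrMr// mul1r.
  - by rewrite mulrC -ler_pdivlMr ?mulr_gt0// /k ge_min lexx.
  - have kle : k <= (2 * (a 0%N + 1))^-1 by rewrite /k ge_min lexx orbT.
    have a1 : 0 < 2 * (a 0%N + 1) by rewrite mulr_gt0// ltr_wpDl.
    have : k * (2 * (a 0%N + 1)) <= 1 by rewrite -ler_pdivlMr// div1r.
    have := a_le t; have := a0 t; nra.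
apply: quadratic_decrease_littleo => // k k0.
(* Since [K >= 1], [K^2 >= K >= 2 L k]. *)
pose K := 2 * L * k + 1.
have K0 : 0 < K by rewrite addr_gt0// !mulr_gt0.
(* The first entry makes sharpness applicable; the second is the distance to a minimizer at which
   [upper] holds. *)
pose e := Num.min rho (A * K^-1 `^ q / (K * D)).
have e0 : 0 < e.
  by rewrite lt_min rho0 divr_gt0 ?mulr_gt0// powR_gt0// invr_gt0.
have [r r0 near_min] := near_argmin C0 cC cf e0.
near=> t.
have ar : a t < r by near: t; exact: a_small.
have ak : a t < (2 * k)^-1 by near: t; apply: a_small; rewrite invr_gt0 mulr_gt0.
have [m Mm xm] := near_min _ (Cx t) ar.
apply: (step t K) => //; first exact: ltW.
- rewrite leNgt; apply/negP => gap_lt.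
  set g := rel_grad C f (x t).
  (* Otherwise [K * a t * fw_dist <= a t <= fw_gap], against [gap_lt]. *)
  have dK : K^-1 <= fw_dist C S f (x t).
    rewrite -div1r ler_pdivrMr// mulrC leNgt; apply/negP => Kd.
    by have := a_gap t; have := a0 t; nra.
  have ag : a t <= enorm g * enorm (x t - m).
    apply: le_trans (cauchy_schwarz _ _); rewrite /a (inf_argmin Mm).
    by apply: rel_grad_convex => //; exact: Mm.1.
  have xrho : edist_set (x t) (argmin C f) < rho.
    apply: le_lt_trans (edist_set_le _ Mm) (lt_le_trans xm _).
    by rewrite ge_min lexx.
  have sharp := lds _ _ (Cx t) xrho (dir_space_rel_grad C f (x t)).
  rewrite -/(fw_vertex C S f _) -/(fw_gap C S f _) -/(fw_dist C S f _) -/g in sharp.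
  have pow_le : K^-1 `^ q <= fw_dist C S f (x t) `^ q.
    apply: ge0_ler_powR; rewrite ?nnegrE ?enorm_ge0 ?invr_ge0 ?(ltW K0)//.
    exact: le_trans q2.
  have g0 : 0 <= enorm g by exact: enorm_ge0.
  have lower : A * enorm g * K^-1 `^ q < K * D * (enorm g * enorm (x t - m)).
    apply: (@le_lt_trans _ _ (fw_gap C S f (x t))).
      by apply: le_trans sharp; rewrite ler_wpM2l// mulr_ge0// ltW.
    apply: (lt_le_trans gap_lt); rewrite mulrAC.
    apply: ler_pM => //; rewrite ?mulr_ge0 ?enorm_ge0 ?(ltW K0)//.
    by rewrite ler_wpM2l// ltW.
  have upper : enorm (x t - m) * (K * D) <= A * K^-1 `^ q.
    rewrite -ler_pdivlMr ?mulr_gt0// (le_trans (ltW xm))//.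
    by rewrite ge_min lexx orbT.
  (* Multiplying by [enorm g] instead of cancelling it covers a zero gradient: the strict [lower] is
     contradicted either way. *)
  have := ler_wpM2l g0 upper.
  by move: lower; lra.
- by rewrite /K; have := mulr_gt0 L0 k0; nra.
- by rewrite mulrC -ler_pdivlMr ?mulr_gt0// div1r ltW.
Unshelve. all: by end_near. Qed.
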